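(* Let $m$ be a fixed natural number and let $q>0$. Then $\mathcal{P}_{as(q;1)}(^mX)=\mathcal{P}(^mX)$ for every Banach space $X$ if and only if $q\ge 1$.
   Context: The scalar field $\mathbb{K}$ is either $\mathbb{R}$ or $\mathbb{C}$. $\mathcal{P}(^mX)$ is the Banach space of continuous $m$-homogeneous polynomials $P:X\to\mathbb{K}$. For a finite sequence $(x_j)_{j=1}^k$ in $X$ and $r>0$, $\|(x_j)_{j=1}^k\|_{w,r}=\sup_{\varphi\in B_{X'}}\left(\sum_{j=1}^k|\varphi(x_j)|^r\right)^{1/r}$, where $B_{X'}$ is the closed unit ball of the dual $X'$. A continuous $m$-homogeneous polynomial $P:X\to\mathbb{K}$ is absolutely $(p;r)$-summing if there is a constant $L\ge 0$ such that $\left(\sum_{j=1}^k|P(x_j)|^p\right)^{1/p}\le L\,\|(x_j)_{j=1}^k\|_{w,r}^m$ for every $k\in\mathbb{N}$ and all $x_1,\dots,x_k\in X$; the space of these is $\mathcal{P}_{as(p;r)}(^mX)$. (The notion is of interest for $p\ge r/m$; for $p<r/m$ only the zero polynomial satisfies the inequality.) *)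

(* Defs.v *)
From mathcomp Require Import all_boot all_order all_algebra.
From mathcomp Require Import complex.
From mathcomp Require Import all_classical all_reals all_analysis.

Set Implicit Arguments.
Unset Strict Implicit.
Unset Printing Implicit Defensive.

Import Order.TTheory GRing.Theory Num.Theory numFieldNormedType.Exports.

Local Open Scope classical_set_scope.
Local Open Scope ring_scope.
Local Open Scope complex_scope.

Variant scalars := RealScalars | ComplexScalars.

Definition scalar_field (R : realType) (s : scalars) : numFieldType :=
  match s with
  | RealScalars => R
  | ComplexScalars => R[i]
  end.

Definition real_part (R : realType) (s : scalars) : scalar_field R s -> R :=
  match s return scalar_field R s -> R with
  | RealScalars => fun x => x
  | ComplexScalars => fun x => complex.Re x
  end.

(* The norm of a normed space over K takes its values in K; since `|v| is real
   and nonnegative, taking its real part only transports it to R, where real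
   powers and suprema are available. *)
Definition rnorm (R : realType) (s : scalars)
    (V : normedZmodType (scalar_field R s)) (v : V) : R :=
  real_part `|v|.

Section Polynomials.
Variables (R : realType) (s : scalars).
Local Notation K := (scalar_field R s).
Variable X : normedModType K.

Definition multilinear_form (m : nat) (A : ('I_m -> X) -> K) : Prop :=
  forall (v : 'I_m -> X) (i : 'I_m), scalar (fun x : X => A (dfwith v i x)).

Definition homogeneous_poly (m : nat) (P : X -> K) : Prop :=
  exists2 A : ('I_m -> X) -> K,
    multilinear_form A & forall x : X, P x = A (fun=> x).

Definition continuous_poly (m : nat) : set (X -> K) :=
  [set P | homogeneous_poly m P /\ continuous P].

(* The functional norm being sup_(|x| <= 1) |phi x|, the bound below says that
   it is at most 1. *)
Definition dual_unit_ball : set {scalar X} :=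
  [set phi | continuous (phi : X -> K) /\
             forall x : X, `|x| <= 1 -> `|phi x| <= 1].

(* For r > 0 the set of reals whose sup is taken is nonempty (phi = 0) and
   bounded by (\sum_j |x_j| ^ r) ^ (1/r), so this is a genuine supremum. *)
Definition weak_norm (r : R) (k : nat) (x : 'I_k -> X) : R :=
  sup [set (\sum_(j < k) rnorm (phi (x j)) `^ r) `^ r^-1
      | phi in dual_unit_ball].

Definition abs_summing (p r : R) (m : nat) (P : X -> K) : Prop :=
  exists2 L : R, 0 <= L &
    forall (k : nat) (x : 'I_k -> X),
      (\sum_(j < k) rnorm (P (x j)) `^ p) `^ p^-1 <= L * weak_norm r x ^+ m.

Definition abs_summing_poly (p r : R) (m : nat) : set (X -> K) :=
  [set P | continuous_poly m P /\ abs_summing p r m P].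

End Polynomials.

Arguments continuous_poly {R s} X m.
Arguments abs_summing_poly {R s} X p r m.

(* Main.v *)
(** For [1 <= q] it suffices to treat [q = 1] (Defant-Voigt). By Hahn-Banach,
    [|\sum_j t_j x_j| <= B w] whenever all [|t_j| <= B], where [w] is the weak
    1-norm of [(x_j)]. Let [P] be the diagonal of a multilinear form and pick
    [eps_j] with [eps_j * P (x_j) = |P (x_j)|]. Take independent signs [e_ij]
    for [i <> i0], coefficients [c_ij = e_ij] for [i <> i0] and
    [c_(i0)j = eps_j * \prod_(i <> i0) e_ij], so that
    [E (\prod_i c_(i, h i)) = eps_j] if [h] is constantly [j] and [0]
    otherwise. Polarizing with a second family of signs [d_i], the mean of
    [(\prod_i d_i) * P (\sum_j (\sum_i d_i c_ij) x_j)] is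
    [m! * \sum_j |P (x_j)|], while each term is at most [|P| (m w) ^ m].

    For [q < 1] take [P x = \sum_n a_n x_n ^ m] on the space of bounded
    sequences, with [a] summable and [\sum_n a_n ^ q] divergent: the unit
    vectors have weak 1-norm at most [1] and [P] maps the [n]-th one to [a_n].
*)
Require Import Defs.
From HB Require Import structures.
From mathcomp Require Import all_boot all_order all_algebra.
From mathcomp Require Import complex.
From mathcomp Require Import all_classical all_reals all_analysis.
From mathcomp Require Import ring lra.
Import Order.TTheory GRing.Theory Num.Theory numFieldNormedType.Exports.
Set Implicit Arguments.
Unset Strict Implicit.
Unset Printing Implicit Defensive.
Local Open Scope classical_set_scope.
Local Open Scope ring_scope.
Local Open Scope complex_scope.

(** * Real and complex scalars *)

Section ScalarField.
Variables (R : realType) (s : scalars).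
Local Notation K := (scalar_field R s).

Definition emb : R -> K :=
  match s return R -> scalar_field R s with
  | RealScalars => id
  | ComplexScalars => fun r => r%:C
  end.

Lemma emb_is_zmod_morphism : zmod_morphism emb.
Proof. by rewrite /emb; case: s => // x y; rewrite rmorphB. Qed.

Lemma emb_is_monoid_morphism : monoid_morphism emb.
Proof. by rewrite /emb; case: s => //; split=> [|x y]; rewrite ?rmorph1 ?rmorphM. Qed.

HB.instance Definition _ := GRing.isZmodMorphism.Build R K emb emb_is_zmod_morphism.
HB.instance Definition _ :=
  GRing.isMonoidMorphism.Build R K emb emb_is_monoid_morphism.

Lemma embK : cancel emb (@real_part R s).
Proof. by rewrite /emb; case: s. Qed.

Lemma ler_emb : {mono emb : x y / x <= y}.
Proof. by rewrite /emb; case: s => // x y; rewrite lecR. Qed.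

Lemma ltr_emb : {mono emb : x y / x < y}.
Proof. by rewrite /emb; case: s => // x y; rewrite ltcR. Qed.

Lemma emb_real_part (z : K) : 0 <= z -> emb (real_part z) = z.
Proof.
by rewrite /emb; move: z; case: s => //= -[a b]; rewrite lecE /= => /andP[/eqP->].
Qed.

Lemma gt0_emb (e : K) : 0 < e -> exists2 r : R, 0 < r & emb r = e.
Proof.
move=> e0; exists (real_part e); last exact/emb_real_part/ltW.
by rewrite -ltr_emb emb_real_part ?ltW// rmorph0.
Qed.

Section NormedZmod.
Variable V : normedZmodType K.
Implicit Types v w : V.

Lemma emb_rnorm v : emb (rnorm v) = `|v|.
Proof. exact: emb_real_part. Qed.

Lemma rnormP v r : `|v| = emb r -> rnorm v = r.
Proof. by rewrite /rnorm => ->; exact: embK. Qed.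

Lemma rnorm_ge0 v : 0 <= rnorm v.
Proof. by rewrite -ler_emb rmorph0 emb_rnorm. Qed.

Lemma ler_rnormD v w : rnorm (v + w) <= rnorm v + rnorm w.
Proof. by rewrite -ler_emb rmorphD /= !emb_rnorm; exact: ler_normD. Qed.

Lemma ler_rnorm_sum (I : Type) (r : seq I) (P : pred I) (F : I -> V) :
  rnorm (\sum_(i <- r | P i) F i) <= \sum_(i <- r | P i) rnorm (F i).
Proof.
rewrite -ler_emb rmorph_sum /= emb_rnorm (eq_bigr _ (fun i _ => emb_rnorm (F i))).
exact: ler_norm_sum.
Qed.

Lemma rnorm0_eq0 v : rnorm v = 0 -> v = 0.
Proof. by move=> v0; apply: normr0_eq0; rewrite -emb_rnorm v0 rmorph0. Qed.

Lemma rnorm0 : rnorm (0 : V) = 0.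
Proof. by apply: rnormP; rewrite normr0 rmorph0. Qed.

Lemma rnormN v : rnorm (- v) = rnorm v.
Proof. by rewrite /rnorm normrN. Qed.

Lemma ler_norm_emb v r : (`|v| <= emb r) = (rnorm v <= r).
Proof. by rewrite -emb_rnorm ler_emb. Qed.

Lemma ltr_norm_emb v r : (`|v| < emb r) = (rnorm v < r).
Proof. by rewrite -emb_rnorm ltr_emb. Qed.

End NormedZmod.

Lemma rnormZ (X : normedModType K) (a : K) (x : X) :
  rnorm (a *: x) = rnorm a * rnorm x.
Proof. by apply: rnormP; rewrite normrZ rmorphM /= !emb_rnorm. Qed.

Lemma rnormM (a b : K) : rnorm (a * b) = rnorm a * rnorm b.
Proof. by apply: rnormP; rewrite normrM rmorphM /= !emb_rnorm. Qed.

Lemma rnorm1 : rnorm (1 : K) = 1.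
Proof. by apply: rnormP; rewrite normr1 rmorph1. Qed.

Lemma rnormX (a : K) n : rnorm (a ^+ n) = rnorm a ^+ n.
Proof. by apply: rnormP; rewrite normrX rmorphXn /= !emb_rnorm. Qed.

Lemma rnormV (a : K) : rnorm a^-1 = (rnorm a)^-1.
Proof. by apply: rnormP; rewrite normfV fmorphV /= !emb_rnorm. Qed.

Lemma rnorm_prod (I : Type) (r : seq I) (P : pred I) (F : I -> K) :
  rnorm (\prod_(i <- r | P i) F i) = \prod_(i <- r | P i) rnorm (F i).
Proof.
apply: rnormP; rewrite normr_prod rmorph_prod /=.
by apply: eq_bigr => i _; rewrite emb_rnorm.
Qed.

Lemma rnorm_emb (r : R) : 0 <= r -> rnorm (emb r) = r.
Proof.
by move=> r0; apply: rnormP; rewrite ger0_norm// -(rmorph0 emb) ler_emb.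
Qed.

Lemma rnorm_sign (b : bool) : rnorm ((-1) ^+ b : K) = 1.
Proof. by rewrite rnormX rnormN rnorm1 expr1n. Qed.

Lemma real_part_le (z : K) : real_part z <= rnorm z.
Proof.
rewrite /rnorm; move: z; case: s => [z|[a b]] /=; first exact: ler_norm.
by rewrite (le_trans (ler_norm a))// -sqrtr_sqr ler_wsqrtr// lerDl sqr_ge0.
Qed.

Lemma rnorm_norm (V : normedZmodType K) (v : V) : rnorm `|v| = rnorm v.
Proof. by apply: rnormP; rewrite normr_id emb_rnorm. Qed.

(* At [z = 0] the witness [`|z| / z] is [0], hence only [<= 1]. *)
Lemma exists_unit_rotation (z : K) :
  exists2 c : K, rnorm c <= 1 & c * z = emb (rnorm z).
Proof.
exists (`|z| / z); have [->|z0] := eqVneq z 0.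
- by rewrite invr0 mulr0 rnorm0 ler01.
- rewrite rnormM rnormV rnorm_norm divff//.
  by apply: contra_neq z0; exact: rnorm0_eq0.
- by rewrite mulr0 rnorm0 rmorph0.
- by rewrite divfK// emb_rnorm.
Qed.

(** An estimate on the unit ball around the single point [x] suffices, so [C] may depend on [x], as
    it must for polynomials of degree above 1. *)
Lemma locally_lipschitz_continuous (X : normedModType K) (f : X -> K) (x : X)
    (C : R) : 0 < C ->
  (forall y, rnorm (x - y) < 1 -> rnorm (f x - f y) <= rnorm (x - y) * C) ->
  f @ x --> f x.
Proof.
move=> C0 fC; apply/cvgrPdist_lt => _ /gt0_emb[e e0 <-].
have d0 : 0 < Num.min 1 (e / C) by rewrite lt_min ltr01 divr_gt0.
have /cvgrPdist_lt/(_ (emb (Num.min 1 (e / C)))) : id @ x --> x by [].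
rewrite -(rmorph0 emb) ltr_emb => /(_ d0); apply: filterS => y.
rewrite !ltr_norm_emb lt_min => /andP[xy1 xye].
by rewrite (le_lt_trans (fC _ xy1))// -ltr_pdivlMr.
Qed.

End ScalarField.

(** * Hahn-Banach and the weak 1-norm *)

Section HahnBanach.
Variables (R : realType) (V : lmodType R) (p : V -> R).
Hypothesis pD : forall x y, p (x + y) <= p x + p y.
Hypothesis pZ : forall t x, p (t *: x) = `|t| * p x.

(** Partial functionals are encoded by their graphs: extension becomes inclusion and a chain has its
    union as upper bound. *)
Let subspace (G : set (V * R)) := forall t u v,
  G u -> G v -> G (t *: u.1 + v.1, t * u.2 + v.2).

Let dominated (G : set (V * R)) := forall u, G u -> u.2 <= p u.1.

Let p0 : p 0 = 0.
Proof. by rewrite -(scale0r 0) pZ normr0 mul0r. Qed.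

Let pN x : p (- x) = p x.
Proof. by rewrite -scaleN1r pZ normrN1 mul1r. Qed.

(** Both (0, r' - r) and (0, r - r') lie in the graph, and domination bounds their second components
    by p 0 = 0. *)
Let graph_functional (G : set (V * R)) x r r' :
  subspace G -> dominated G -> G (x, r) -> G (x, r') -> r = r'.
Proof.
move=> subG domG Gr Gr'; apply/eqP; rewrite eq_le.
have := domG _ (subG (-1) _ _ Gr Gr'); have := domG _ (subG (-1) _ _ Gr' Gr).
by rewrite /= scaleN1r addNr p0; lra.
Qed.

(** The value [c] at [x0] must lie above all u.2 - p (u.1 - x0) and below all p (v.1 + x0) - v.2.
    Subadditivity puts every lower bound below every upper one, so the supremum of the lower bounds
    works. *)
Let graph_extension (G : set (V * R)) x0 :
  subspace G -> dominated G -> G (0, 0) ->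
  exists c, let G' := [set w | exists u t,
      G u /\ w = (u.1 + t *: x0, u.2 + t * c)] in
    subspace G' /\ dominated G'.
Proof.
move=> subG domG G0.
have scaleG t u : G u -> G (t *: u.1, t * u.2).
  by move=> Gu; have := subG t _ _ Gu G0; rewrite /= !addr0.
pose S := [set u.2 - p (u.1 - x0) | u in G].
have ubS v : G v -> ubound S (p (v.1 + x0) - v.2).
  move=> Gv _ [u Gu <-]; have /= := domG _ (subG 1 _ _ Gu Gv).
  rewrite scale1r mul1r; have := pD (u.1 - x0) (v.1 + x0).
  by rewrite addrACA addNr addr0; lra.
have S0 : S !=set0 by exists (0 - p (0 - x0)), (0, 0).
have lec u : G u -> u.2 - p (u.1 - x0) <= sup S.
  move=> Gu; apply: ub_le_sup; last by exists u.
  by exists (p (0 + x0) - 0); exact: (ubS _ G0).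
have gec u : G u -> sup S <= p (u.1 + x0) - u.2.
  by move=> Gu; apply: ge_sup => //; exact: ubS.
exists (sup S); set c := sup S in lec gec *; split.
  move=> t _ _ [u [a [Gu ->]]] [v [b [Gv ->]]].
  exists (t *: u.1 + v.1, t * u.2 + v.2), (t * a + b); split; first exact: subG.
  by congr (_, _) => /=; [rewrite scalerDr scalerDl scalerA addrACA | ring].
(* Dividing by |t| reduces domination to the two inequalities on [c]: the lower one for t < 0, the
   upper one for t > 0. *)
move=> _ [u [t [Gu ->]]] /=; have [t0|t0|->] := ltgtP t 0.
- have := lec _ (scaleG (- t^-1) _ Gu); rewrite /= -(ler_pM2l (_ : 0 < - t)) ?oppr_gt0//.
  rewrite mulrBr mulrA mulrNN divff ?lt_eqF// mul1r.
  rewrite -[X in X * p _](@gtr0_norm _ (- t)) ?oppr_gt0// -pZ scalerBr scalerA.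
  by rewrite mulrNN divff ?lt_eqF// scale1r scaleNr opprK; lra.
- have := gec _ (scaleG t^-1 _ Gu); rewrite /= -(ler_pM2l t0).
  rewrite mulrBr mulrA divff ?gt_eqF// mul1r.
  rewrite -[X in X * p _]gtr0_norm// -pZ scalerDr scalerA divff ?gt_eqF//.
  by rewrite scale1r; lra.
- by rewrite scale0r mul0r !addr0; exact: domG.
Qed.

Theorem hahn_banach_norming z :
  exists f : V -> R, [/\ scalar f, forall x, f x <= p x & f z = p z].
Proof.
(* Zorn's lemma also asks for the union of the empty chain, which is the empty graph; hence (z, p z)
   is demanded of nonempty graphs only. *)
pose good G := [/\ subspace G, dominated G & G !=set0 -> G (z, p z)].
have [|G [[subG domG Gz] maxG]] := @Zorn_bigcup _ good.
  move=> F goodF totF; split.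
  - move=> t u v [A FA Au] [B FB Bv]; have [AB|BA] := totF _ _ FA FB.
      by exists B => //; have [subB _ _] := goodF _ FB; apply: subB => //; exact: AB.
    by exists A => //; have [subA _ _] := goodF _ FA; apply: subA => //; exact: BA.
  - by move=> u [A FA Au]; have [_ domA _] := goodF _ FA; exact: domA.
  - move=> [u [A FA Au]]; exists A => //; have [_ _] := goodF _ FA; apply.
    by exists u.
(* Otherwise the maximal graph would be empty, and the line through (z, p z) would be a larger good
   graph; it is dominated because p z is nonnegative. *)
have {}Gz : G (z, p z).
  apply: contrapT => Gz'; pose L := [set w | exists t, w = (t *: z, t * p z)].
  apply: (maxG L).
    split; first by move=> w Gw; exfalso; apply/Gz'/Gz; exists w.
    by move=> LG; apply/Gz'/LG; exists 1; rewrite scale1r mul1r.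
  split.
  - move=> t _ _ [a ->] [b ->]; exists (t * a + b).
    by rewrite /= scalerDl mulrDl scalerA mulrA.
  - move=> _ [t ->] /=; rewrite pZ ler_wpM2r ?ler_norm//.
    by have := pD z (- z); rewrite subrr p0 pN; lra.
  - by move=> _; exists 1; rewrite scale1r mul1r.
have G0 : G (0, 0).
  by have := subG (-1) _ _ Gz Gz; rewrite /= scaleN1r mulN1r !addNr.
have totalG x : exists r, G (x, r).
  apply: contrapT => Gx; have [c /= [subG' domG']] := graph_extension x subG domG G0.
  set G' := [set w | _] in subG' domG'.
  have GG' : G `<=` G'.
    by move=> u Gu; exists u, 0; split=> //; rewrite scale0r mul0r !addr0; case: u {Gu}.
  apply: (maxG G').
    split=> // G'G; apply: Gx; exists c; apply: G'G; exists (0, 0), 1.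
    by rewrite /= scale1r mul1r !add0r.
  by split=> // _; exact: GG'.
have [f Gf] := choice totalG; exists f; split.
- move=> t x y; apply: (graph_functional subG domG (Gf _)).
  exact: (subG t _ _ (Gf x) (Gf y)).
- by move=> x; exact: (domG _ (Gf x)).
- exact: (graph_functional subG domG (Gf z) Gz).
Qed.

End HahnBanach.

(** * Norming functionals over both scalar fields *)

Section NormingFunctional.
Variables (R : realType) (s : scalars).
Local Notation K := (scalar_field R s).

(** A copy of [X] that carries the real vector space structure, so that the real Hahn-Banach theorem
    applies whatever K is. *)
Definition real_restriction (X : normedModType K) : Type := X.

Section RealRestriction.
Variable X : normedModType K.

HB.instance Definition _ := GRing.Zmodule.on (real_restriction X).

Definition real_scale (r : R) (x : real_restriction X) : real_restriction X :=
  emb s r *: (x : X).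

Lemma real_scaleA a b x : real_scale a (real_scale b x) = real_scale (a * b) x.
Proof. by rewrite /real_scale rmorphM scalerA. Qed.

Lemma real_scale1 : left_id 1 real_scale.
Proof. by move=> x; rewrite /real_scale rmorph1 scale1r. Qed.

Lemma real_scaleDr : right_distributive real_scale +%R.
Proof. by move=> a x y; exact: scalerDr. Qed.

Lemma real_scaleDl x : {morph real_scale^~ x : a b / a + b}.
Proof. by move=> a b; rewrite /real_scale rmorphD scalerDl. Qed.

HB.instance Definition _ := GRing.Zmodule_isLmodule.Build R (real_restriction X)
  real_scaleA real_scale1 real_scaleDr real_scaleDl.

End RealRestriction.
End NormingFunctional.

Lemma norming_real_functional (R : realType) (s : scalars)
    (X : normedModType (scalar_field R s)) (z : X) :
  exists u : X -> R, [/\ forall r x y, u (emb s r *: x + y) = r * u x + u y,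
    forall x, u x <= rnorm x & u z = rnorm z].
Proof.
have [||u [u_lin ule uz]] := @hahn_banach_norming R (real_restriction X)
  (fun x => rnorm (x : X)) _ _ z.
- exact: ler_rnormD.
- move=> t x; rewrite rnormZ; congr (_ * _).
  apply: rnormP; rewrite /emb; case: s {X z x} => //.
  by rewrite normc_def/= expr0n addr0 sqrtr_sqr.
by exists u; split.
Qed.

(* A complex functional is determined by its real part [u] through
   [phi x = u x - i u (i x)]. *)
Lemma scalar_of_real_part (R : realType) (s : scalars)
    (X : normedModType (scalar_field R s)) (u : X -> R) :
  (forall r x y, u (emb s r *: x + y) = r * u x + u y) ->
  exists phi : {scalar X}, forall x, real_part (phi x) = u x.
Proof.
case: s X u => X u u_lin.
- have u_scal : scalar u by [].
  pose M := GRing.isLinear.Build _ _ _ _ (u : X -> R) u_scal.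
  by exists (HB.pack_for {scalar X} (u : X -> scalar_field R RealScalars) M).
- pose phi x : scalar_field R ComplexScalars := (u x) -i* (u ('i *: x)).
  have phi_scal : scalar phi.
    have uD x y : u (x + y) = u x + u y.
      by have := u_lin 1 x y; rewrite rmorph1 scale1r mul1r.
    have u0 : u 0 = 0 by apply: (addrI (u 0)); rewrite -uD !addr0.
    have uZ r x : u (r%:C *: x) = r * u x.
      by have := u_lin r x 0; rewrite addr0 u0 addr0.
    have phiD x y : phi (x + y) = phi x + phi y.
      by rewrite /phi scalerDr !uD opprD.
    have phiZ r x : phi (r%:C *: x) = r%:C * phi x.
      rewrite /phi scalerA mulrC -scalerA !uZ.
      by simpc.
    have phi_i x : phi ('i *: x) = 'i * phi x.
      rewrite /phi scalerA -expr2 sqr_i -[-1 in LHS](rmorphN1 (real_complex R)) uZ.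
      by simpc.
    move=> a x y; rewrite phiD [a]complexE scalerDl phiD -scalerA phi_i !phiZ.
    by rewrite mulrDl mulrA.
  pose M := GRing.isLinear.Build _ _ _ _ phi phi_scal.
  by exists (HB.pack_for {scalar X} phi M).
Qed.

(** The real functional [u] is the real part of some [phi]. To bound |phi x|, rotate by [c] so that
    c * phi x = |phi x|; this is real, hence equal to u (c x), which is at most |x|. *)
Lemma exists_norming_functional (R : realType) (s : scalars)
    (X : normedModType (scalar_field R s)) (z : X) :
  exists2 phi : {scalar X}, dual_unit_ball phi & rnorm z <= rnorm (phi z).
Proof.
have [u [u_lin ule uz]] := norming_real_functional z.
have [phi phi_u] := scalar_of_real_part u_lin.
have phile x : rnorm (phi x) <= rnorm x.
  have [c c1 cphi] := exists_unit_rotation (phi x).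
  rewrite -[leLHS](@embK R s) -cphi -linearZ/= phi_u (le_trans (ule _))// rnormZ.
  by rewrite ler_piMl ?rnorm_ge0.
exists phi; last by rewrite -uz -phi_u real_part_le.
split.
  move=> x; apply: (locally_lipschitz_continuous ltr01) => y _.
  by rewrite mulr1 -linearB phile.
move=> x; apply: le_trans; by rewrite -[leRHS]emb_rnorm ler_norm_emb.
Qed.

(** * The weak 1-norm *)

Section WeakNorm.
Variables (R : realType) (s : scalars).
Local Notation K := (scalar_field R s).
Variable X : normedModType K.

Lemma dual_unit_ballP (phi : {scalar X}) :
  dual_unit_ball phi -> forall x, rnorm (phi x) <= rnorm x.
Proof.
move=> [_ phi1] x; have [->|x0] := eqVneq x 0; first by rewrite raddf0 !rnorm0.
have := phi1 (`|x|^-1 *: x); rewrite normrZ normfV normr_id mulVf ?normr_eq0//.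
move=> /(_ (lexx _)); rewrite linearZ/= normrM normfV normr_id mulrC.
by rewrite ler_pdivrMr ?normr_gt0// mul1r -!emb_rnorm ler_emb.
Qed.

Lemma weak_norm1_ub k (x : 'I_k -> X) (phi : {scalar X}) :
  dual_unit_ball phi -> \sum_(j < k) rnorm (phi (x j)) <= weak_norm 1 x.
Proof.
have E (psi : {scalar X}) : (\sum_(j < k) rnorm (psi (x j)) `^ 1) `^ 1^-1
    = \sum_(j < k) rnorm (psi (x j)).
  rewrite invr1 powRr1; last by apply: sumr_ge0 => j _; exact: powR_ge0.
  by apply: eq_bigr => j _; rewrite powRr1// rnorm_ge0.
move=> phi1; rewrite -E; apply: ub_le_sup; last by exists phi.
(* The supremum is an upper bound only once the set is known to be bounded; the sum of the norms
   bounds it. *)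
exists (\sum_(j < k) rnorm (x j)) => _ [psi psi1 <-].
by rewrite E ler_sum// => j _; exact: dual_unit_ballP.
Qed.

Lemma weak_norm1_ge0 k (x : 'I_k -> X) : 0 <= weak_norm 1 x.
Proof.
have [phi phi1 _] := exists_norming_functional (0 : X).
apply: le_trans (weak_norm1_ub x phi1); apply: sumr_ge0 => j _.
exact: rnorm_ge0.
Qed.

Lemma rnorm_sum_le_weak_norm k (x : 'I_k -> X) (c : 'I_k -> K) (B : R) :
  0 <= B -> (forall j, rnorm (c j) <= B) ->
  rnorm (\sum_(j < k) c j *: x j) <= B * weak_norm 1 x.
Proof.
move=> B0 cB.
have [phi phi1 /le_trans->//] := exists_norming_functional (\sum_j c j *: x j).
rewrite linear_sum (le_trans (ler_rnorm_sum _ _ _))//.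
rewrite (le_trans _ (ler_wpM2l B0 (weak_norm1_ub x phi1)))// mulr_sumr.
by apply: ler_sum => j _; rewrite linearZ/= rnormM ler_wpM2r ?rnorm_ge0.
Qed.
End WeakNorm.

(** * Expansion of multilinear forms *)

Section MultilinearExpansion.
Variables (R : realType) (s : scalars).
Local Notation K := (scalar_field R s).
Variables (X : normedModType K) (m : nat) (A : ('I_m -> X) -> K).
Hypothesis multiA : multilinear_form A.

Lemma multilinear_form_sum_slot (v : 'I_m -> X) i (I : finType) (c : I -> K)
    (z : I -> X) :
  A (dfwith v i (\sum_a c a *: z a)) = \sum_a c a * A (dfwith v i (z a)).
Proof.
pose M := GRing.isLinear.Build _ _ _ _ _ (multiA v i).
pose f := HB.pack_for {scalar X} (fun x : X => A (dfwith v i x)) M.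
rewrite -[LHS]/(f _) linear_sum; apply: eq_bigr => a _.
by rewrite linearZ.
Qed.

(* The slots are expanded one at a time: outside the list [r] the coefficient
   family of a slot is already concentrated on a single index. *)
Lemma multilinear_form_sum (I : finType) (c : 'I_m -> I -> K) (z : I -> X) :
  A (fun l => \sum_a c l a *: z a) =
  \sum_(f : {ffun 'I_m -> I}) (\prod_l c l (f l)) * A (fun l => z (f l)).
Proof.
suff H (r : seq 'I_m) (d : 'I_m -> I -> K) :
    (forall l, l \notin r -> exists b, forall a, d l a = (a == b)%:R) ->
    A (fun l => \sum_a d l a *: z a) =
    \sum_(f : {ffun 'I_m -> I}) (\prod_l d l (f l)) * A (fun l => z (f l)).
  by apply: (H (enum 'I_m)) => l; rewrite mem_enum.
elim: r d => [|l r IHr] d dP.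
  have /choice[b db] : forall l, exists b, forall a, d l a = (a == b)%:R.
    by move=> l; exact: dP.
  (* With every slot concentrated on one index, [b] is the only function with a nonzero
     coefficient. *)
  rewrite (bigD1 (finfun b))//= [X in _ + X]big1 ?addr0 => [|f fb].
    rewrite big1 ?mul1r => [|l _]; last by rewrite db ffunE eqxx.
    congr A; apply/funext => l; rewrite ffunE (bigD1 (b l))//= db eqxx scale1r.
    by rewrite big1 ?addr0// => a /negPf ab; rewrite db ab scale0r.
  have [l fbl] : exists l, f l != b l.
    apply/existsP; apply: contraNT fb => /existsPn fb; apply/eqP/ffunP => l.
    by rewrite ffunE; apply/eqP; rewrite -[_ == _]negbK.
  by rewrite (bigD1 l)//= db (negPf fbl) !mul0r.
(* In [d' a] the slot [l] is concentrated on [a], so the induction hypothesis for [r] applies to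
   it. *)
pose d' a := dfwith d l (fun a' => (a' == a)%:R : K).
have -> : (fun l => \sum_a d l a *: z a) =
    dfwith (fun l => \sum_a d l a *: z a) l (\sum_a d l a *: z a).
  apply/funext => l'; have [<-|ll'] := eqVneq l l'; first by rewrite dfwithin.
  by rewrite dfwithout.
rewrite multilinear_form_sum_slot.
transitivity (\sum_a d l a *
    \sum_(f : {ffun 'I_m -> I}) (\prod_l d' a l (f l)) * A (fun l => z (f l))).
  apply: eq_bigr => a _; congr (_ * _); rewrite -IHr; last first.
    move=> l' l'r; rewrite /d'; have [<-|ll'] := eqVneq l l'.
      by exists a => a'; rewrite dfwithin.
    by rewrite dfwithout//; apply: dP; rewrite inE negb_or eq_sym ll'.
  congr A; apply/funext => l'; rewrite /d'; have [<-|ll'] := eqVneq l l'.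
    rewrite !dfwithin (bigD1 a)//= eqxx scale1r big1 ?addr0//.
    by move=> a' /negPf aa'; rewrite aa' scale0r.
  by rewrite !dfwithout.
under eq_bigr do rewrite mulr_sumr; rewrite exchange_big; apply: eq_bigr => f _.
(* For a given [f], the factor of slot [l] in [d' a] vanishes unless a = f l. *)
rewrite (bigD1 (f l))//= [X in _ + X]big1 ?addr0 => [|a /negPf af].
  rewrite mulrA; congr (_ * _); rewrite (bigD1 l)//= [RHS](bigD1 l)//= /d' dfwithin.
  rewrite eqxx mul1r; congr (_ * _); apply: eq_bigr => l' l'l.
  by rewrite dfwithout// eq_sym.
by rewrite (bigD1 l)//= /d' dfwithin eq_sym af !mul0r mulr0.
Qed.

(** This is the expansion over a one-element index type, where there is a single function [f]. *)
Lemma multilinear_form_diag_scale (c : K) (x : X) :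
  A (fun=> c *: x) = c ^+ m * A (fun=> x).
Proof.
have /= := multilinear_form_sum (fun _ (_ : 'I_1) => c) (fun=> x).
under eq_fun do rewrite big_ord1; move=> ->.
rewrite (eq_bigr (fun=> c ^+ m * A (fun=> x))) => [|f _]; last first.
  by rewrite prodr_const card_ord.
by rewrite sumr_const card_ffun card_ord exp1n mulr1n.
Qed.

End MultilinearExpansion.

(** * Sign averages *)

Section SignAverages.
Variable K : numFieldType.
Local Notation sg b := ((-1) ^+ nat_of_bool b : K).

Definition flip (T : finType) (a : T) (e : {ffun T -> bool}) : {ffun T -> bool} :=
  [ffun x => (x == a) (+) e x].

Lemma flipK (T : finType) (a : T) : involutive (flip a).
Proof. by move=> e; apply/ffunP => x; rewrite !ffunE addbA addbb. Qed.

(** Reindexing by the involution [flip a] shows that the sum equals its opposite. This replaces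
    independence and mean zero of the signs. *)
Lemma sum_flip_eq0 (T : finType) (a : T) (F : {ffun T -> bool} -> K) :
  (forall e, F (flip a e) = - F e) -> \sum_e F e = 0.
Proof.
move=> Fa; have : \sum_e F e = - \sum_e F e.
  rewrite {1}(reindex_inj (inv_inj (flipK a))) -sumrN; exact: eq_bigr.
by move/eqP; rewrite -addr_eq0 -mulr2n mulrn_eq0 => /eqP.
Qed.

Lemma prod_sg_sqr (T : finType) (P : pred T) (e : T -> bool) :
  (\prod_(i | P i) sg (e i)) * (\prod_(i | P i) sg (e i)) = 1.
Proof. by rewrite -big_split big1// => i _ /=; rewrite -expr2 sqrr_sign. Qed.

(** Polarization, as an unnormalized sum. Distribute the product over maps [g]. If [g] is injective
    it is a permutation and the signs cancel in pairs; otherwise [g] misses some [i], and flipping d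
    i changes the sign of the summand. *)
Lemma sum_sign_prod_sum (m : nat) (c : 'I_m -> 'I_m -> K) :
  \sum_(d : {ffun 'I_m -> bool})
    (\prod_i sg (d i)) * \prod_l \sum_i sg (d i) * c i l =
  #|{ffun 'I_m -> bool}|%:R *
    \sum_(g : {ffun 'I_m -> 'I_m} | injectiveb g) \prod_l c (g l) l.
Proof.
under eq_bigr do rewrite bigA_distr_bigA/= mulr_sumr.
rewrite exchange_big/= (bigID (fun g : {ffun 'I_m -> 'I_m} => injectiveb g))/=.
rewrite [X in _ + X]big1 ?addr0 => [|g ginj].
  rewrite mulr_sumr; apply: eq_bigr => g /injectiveP ginj.
  rewrite (eq_bigr (fun=> \prod_l c (g l) l)) ?sumr_const ?mulr_natl// => d _.
  rewrite big_split/= mulrA [X in X * _](_ : _ = 1) ?mul1r//.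
  by rewrite (reindex_inj ginj)/= (prod_sg_sqr _ (fun i => d (g i))).
have [i gi] : exists i, forall l, g l != i.
  apply: contrapT => onto; move: ginj => /injectiveP; apply.
  suff /image_injP ginj : #|codom g| == #|'I_m| by move=> x y; exact: ginj.
  apply/eqP/eq_card => i; rewrite inE; apply/codomP.
  apply: contrapT => gi; apply: onto; exists i => l; apply/eqP => gl.
  by apply: gi; exists l.
apply: (sum_flip_eq0 (a := i)) => d; rewrite -mulNr; congr (_ * _).
  rewrite (bigD1 i)//= [in RHS](bigD1 i)//= ffunE eqxx -mulNr; congr (_ * _).
    by case: (d i); rewrite !expr0 ?expr1 ?opprK.
  by apply: eq_bigr => l /negPf il; rewrite ffunE il.
by apply: eq_bigr => l _; rewrite ffunE (negPf (gi l)).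
Qed.

Section RademacherCoefficients.
Variables (m k : nat) (i0 : 'I_m) (eps : 'I_k -> K).

Definition rademacher (e : {ffun 'I_m * 'I_k -> bool}) (i : 'I_m) (j : 'I_k) : K :=
  if i == i0 then eps j * \prod_(l | l != i0) sg (e (l, j)) else sg (e (i, j)).

Lemma rademacher_const e j : \prod_i rademacher e i j = eps j.
Proof.
rewrite (bigD1 i0)//= /rademacher eqxx.
rewrite [X in _ * X = _](eq_bigr (fun l => sg (e (l, j)))).
  by rewrite -mulrA prod_sg_sqr mulr1.
by move=> l /negPf ->.
Qed.

(** The sign at (i, h i) occurs in the factor of row [i] and nowhere else: the factor of row [i0]
    involves only signs of column h i0, which differs from h i. Flipping it negates the product. *)
Lemma sum_rademacher_nonconst (h : 'I_m -> 'I_k) i :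
  h i != h i0 -> \sum_e \prod_l rademacher e l (h l) = 0.
Proof.
move=> hi; have ii0 : i != i0 by apply: contra_neq hi => ->.
apply: (sum_flip_eq0 (a := (i, h i))) => e.
rewrite (bigD1 i)//= [in RHS](bigD1 i)//= -mulNr; congr (_ * _).
  rewrite /rademacher (negPf ii0) ffunE eqxx.
  by case: (e _); rewrite !expr0 ?expr1 ?opprK.
apply: eq_bigr => l li; rewrite /rademacher; case: ifPn => [/eqP->|_].
  congr (_ * _); apply: eq_bigr => l' _.
  by rewrite ffunE xpair_eqE [h i0 == _]eq_sym (negPf hi) andbF.
by rewrite ffunE xpair_eqE (negPf li).
Qed.

(** The coefficient of A (x o f) once the signed sum of the values of [P] is expanded by
    multilinearity. *)
Definition sign_weight (f : 'I_m -> 'I_k) : K :=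
  \sum_e \sum_(d : {ffun 'I_m -> bool}) (\prod_i sg (d i)) *
    \prod_l \sum_i sg (d i) * rademacher e i (f l).

Lemma sign_weightE (f : 'I_m -> 'I_k) :
  sign_weight f = #|{ffun 'I_m -> bool}|%:R *
    \sum_(g : {ffun 'I_m -> 'I_m} | injectiveb g)
      \sum_e \prod_l rademacher e (g l) (f l).
Proof.
rewrite /sign_weight; under eq_bigr do rewrite (sum_sign_prod_sum (fun i l => _)).
by rewrite -mulr_sumr exchange_big.
Qed.

Lemma sign_weight_const j :
  sign_weight (fun=> j) =
  (#|{ffun 'I_m -> bool}| * (#|[pred g : {ffun 'I_m -> 'I_m} | injectiveb g]| *
    #|{ffun 'I_m * 'I_k -> bool}|))%:R * eps j.
Proof.
rewrite sign_weightE !natrM -!mulrA; congr (_ * _).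
rewrite (eq_bigr (fun=> #|{ffun 'I_m * 'I_k -> bool}|%:R * eps j)).
  by rewrite [RHS]mulr_natl sumr_const.
move=> g /injectiveP ginj; rewrite (eq_bigr (fun=> eps j)).
  by rewrite sumr_const mulr_natl.
move=> e _; rewrite -(rademacher_const e).
by rewrite [RHS](reindex_inj ginj).
Qed.

(** Reindexing by the inverse [g'] of the permutation [g] replaces [f] by h = f o g', which is still
    nonconstant; so at g l or at g l' it differs from its value at [i0]. *)
Lemma sign_weight_nonconst (f : 'I_m -> 'I_k) l l' :
  f l != f l' -> sign_weight f = 0.
Proof.
move=> fll'; rewrite sign_weightE big1 ?mulr0// => g /injectiveP ginj.
have [g' gK g'K] := injF_bij ginj.
pose h i := f (g' i); have [i hi] : exists i, h i != h i0.
  have [E|] := eqVneq (h (g l)) (h i0); last by exists (g l).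
  exists (g l'); rewrite -E /h !gK eq_sym.
  exact: fll'.
apply: etrans (sum_rademacher_nonconst hi); apply: eq_bigr => e _.
rewrite [RHS](reindex_inj ginj); apply: eq_bigr => i' _.
by rewrite /h gK.
Qed.

End RademacherCoefficients.
End SignAverages.

(** * The case [1 <= q] *)

(** With S the sum of the a_j, each a_j^q = a_j * a_j^(q-1) is at most a_j * S^(q-1), and these
    bounds add up to S^q. *)
Lemma powR_sum_le_sum (R : realType) (q : R) k (a : 'I_k -> R) :
  1 <= q -> (forall j, 0 <= a j) ->
  (\sum_(j < k) a j `^ q) `^ q^-1 <= \sum_(j < k) a j.
Proof.
move=> q1 a0; have q0 : 0 < q by rewrite (lt_le_trans ltr01).
set S := \sum_(j < k) a j; have S0 : 0 <= S by apply: sumr_ge0.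
have aS j : a j <= S by rewrite /S (bigD1 j)//= lerDl sumr_ge0.
suff : \sum_(j < k) a j `^ q <= S `^ q.
  move=> /(ge0_ler_powR (r := q^-1)) le_q.
  apply: (le_trans (le_q _ _ _));
    rewrite ?invr_ge0 ?(ltW q0) ?nnegrE ?powR_ge0 ?sumr_ge0//.
  - by move=> j _; exact: powR_ge0.
  - by rewrite -powRrM divff ?gt_eqF// powRr1.
rewrite -(mulr_powRB1 S0 q0) mulr_suml; apply: ler_sum => j _.
rewrite -(mulr_powRB1 (a0 j) q0) ler_wpM2l//.
by apply: ge0_ler_powR; rewrite ?nnegrE// subr_ge0.
Qed.

Lemma rnorm_sum_le_card (R : realType) (s : scalars)
    (V : normedZmodType (scalar_field R s)) (T : finType) (F : T -> V) (B : R) :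
  (forall t, rnorm (F t) <= B) -> rnorm (\sum_t F t) <= #|T|%:R * B.
Proof.
move=> FB; rewrite (le_trans (ler_rnorm_sum _ _ _))//.
by rewrite mulr_natl -sumr_const; apply: ler_sum.
Qed.

Section DefantVoigt.
Variables (R : realType) (s : scalars).
Local Notation K := (scalar_field R s).
Variables (X : normedModType K) (m : nat).
Hypothesis m_gt0 : (0 < m)%N.

(** Continuity at 0 gives |P| < 1 on a ball of radius [e]. Scaling [x] to norm e / 2 and using
    homogeneity yields the constant (2 / e)^m. *)
Lemma continuous_poly_bounded (P : X -> K) : continuous_poly X m P ->
  exists2 M : R, 0 <= M & forall x, rnorm (P x) <= M * rnorm x ^+ m.
Proof.
move=> [[A multiA PA] cP].
have PZ (c : K) x : P (c *: x) = c ^+ m * P x.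
  by rewrite !PA (multilinear_form_diag_scale multiA).
have P0 : P 0 = 0 by rewrite -(scale0r 0) PZ expr0n eqn0Ngt m_gt0 mul0r.
have /cvgrPdist_lt/(_ _ ltr01)/nbhs_ballP[_/= /gt0_emb[e e0 <-] eP] := cP 0.
exists ((2 / e) ^+ m) => [|x]; first by rewrite exprn_ge0// divr_ge0// ltW.
have [->|x0] := eqVneq x 0.
  by rewrite P0 !rnorm0 expr0n eqn0Ngt m_gt0 mulr0.
have nx0 : 0 < rnorm x.
  by rewrite lt_def rnorm_ge0 andbT; apply: contra_neq x0; exact: rnorm0_eq0.
pose t := e / 2 / rnorm x; have t0 : 0 < t by rewrite !divr_gt0.
have : rnorm (P (emb s t *: x)) <= 1.
  apply: ltW; rewrite -(ltr_emb s) emb_rnorm rmorph1.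
  have /eP : ball (0 : X) (emb s e) (emb s t *: x).
    rewrite -ball_normE/= sub0r normrN ltr_norm_emb rnormZ (rnorm_emb _ (ltW t0)).
    by rewrite divfK ?gt_eqF//; lra.
  by rewrite /= P0 sub0r normrN.
rewrite PZ rnormM rnormX (rnorm_emb _ (ltW t0)) -ler_pdivlMl ?exprn_gt0// mulr1.
by rewrite -exprVn -exprMn /t !invfM !invrK [e^-1 * 2]mulrC.
Qed.

Lemma continuous_poly_abs_summing1 (P : X -> K) : continuous_poly X m P ->
  exists2 L : R, 0 <= L & forall k (x : 'I_k -> X),
    \sum_(j < k) rnorm (P (x j)) <= L * weak_norm 1 x ^+ m.
Proof.
move=> cP; have [M M0 PM] := continuous_poly_bounded cP.
have [[A multiA PA] _] := cP; pose i0 := Ordinal m_gt0.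
(* The signed sum produces the sum of the |P (x_j)| with an extra factor [I], the number of
   permutations, which is bounded below by 1; hence no division by m! here. *)
exists (M * m%:R ^+ m) => [|k x]; first by rewrite mulr_ge0// exprn_ge0.
have [eps eps1 epsP] : exists2 eps : 'I_k -> K, forall j, rnorm (eps j) <= 1 &
    forall j, eps j * P (x j) = emb s (rnorm (P (x j))).
  have /choice[eps epsP] : forall j, exists c : K,
      rnorm c <= 1 /\ c * P (x j) = emb s (rnorm (P (x j))).
    by move=> j; have [c c1 cP'] := exists_unit_rotation (P (x j)); exists c.
  by exists eps => j; have [] := epsP j.
(* The coefficient of x_j in the argument of [P]: a sum of [m] numbers of modulus at most 1. *)
pose t (e : {ffun 'I_m * 'I_k -> bool}) (d : {ffun 'I_m -> bool}) j : K :=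
  \sum_i (-1) ^+ d i * rademacher i0 eps e i j.
have t_le e d j : rnorm (t e d j) <= m%:R.
  rewrite (le_trans (ler_rnorm_sum _ _ _))// -[leRHS]mulr1 mulr_natl.
  rewrite -[in leRHS](card_ord m) -sumr_const; apply: ler_sum => i _.
  rewrite rnormM rnorm_sign mul1r /rademacher; case: ifP => _; last by rewrite rnorm_sign.
  by rewrite rnormM rnorm_prod big1 ?mulr1// => l _; rewrite rnorm_sign.
have [D DE] : exists D, #|{ffun 'I_m -> bool}| = D by exists #|{ffun 'I_m -> bool}|.
have [E EE] : exists E, #|{ffun 'I_m * 'I_k -> bool}| = E.
  by exists #|{ffun 'I_m * 'I_k -> bool}|.
have [I IE] : exists I, #|[pred g : {ffun 'I_m -> 'I_m} | injectiveb g]| = I.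
  by exists #|[pred g : {ffun 'I_m -> 'I_m} | injectiveb g]|.
have average : \sum_e \sum_(d : {ffun 'I_m -> bool})
      (\prod_i (-1) ^+ d i) * P (\sum_j t e d j *: x j) =
    (D * (I * E))%:R * emb s (\sum_j rnorm (P (x j))).
  transitivity (\sum_(f : {ffun 'I_m -> 'I_k})
      sign_weight i0 eps f * A (fun l => x (f l))).
    rewrite /sign_weight.
    under eq_bigr do under eq_bigr do rewrite PA
      (multilinear_form_sum multiA (fun _ => _) x) mulr_sumr.
    under eq_bigr do rewrite exchange_big.
    rewrite exchange_big; apply: eq_bigr => f _; rewrite mulr_suml.
    apply: eq_bigr => e _; rewrite mulr_suml; apply: eq_bigr => d _.
    by rewrite mulrA.
  pose cst_ffun (j : 'I_k) : {ffun 'I_m -> 'I_k} := [ffun=> j].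
  have cst_inj : injective cst_ffun.
    by move=> i j /ffunP/(_ i0); rewrite !ffunE.
  (* Only the constant maps [f] contribute; the weight of the constant [j] carries eps_j, which
     turns P (x_j) into its modulus. *)
  rewrite (bigID (fun f => f \in codom cst_ffun))/=.
  rewrite [X in _ + X]big1 ?addr0 => [|f f_nonconst]; last first.
    have [l fl] : exists l, f l != f i0.
      apply: contrapT => f_const; case/negP: f_nonconst.
      apply/codomP; exists (f i0); apply/ffunP => l; rewrite ffunE.
      by apply/eqP; apply: contrapT => /negP fl; apply: f_const; exists l.
    by rewrite (sign_weight_nonconst _ _ fl) mul0r.
  rewrite (eq_bigl (fun f => f \in [set cst_ffun j | j in 'I_k]%SET)) => [|f]; last first.
    by apply/codomP/imsetP => [[j ->]|[j _ ->]]; exists j.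
  rewrite big_imset/= => [|i j _ _ /cst_inj//].
  rewrite rmorph_sum mulr_sumr; apply: eq_bigr => j _ /=.
  rewrite -epsP PA mulrA -DE -IE -EE -(sign_weight_const i0 eps j); congr (_ * A _).
    by congr sign_weight; apply/funext => l; rewrite ffunE.
  by apply/funext => l; rewrite ffunE.
have D0 : (0 < D)%N by rewrite -DE card_ffun card_bool expn_gt0.
have E0 : (0 < E)%N by rewrite -EE card_ffun card_bool expn_gt0.
have I0 : (0 < I)%N.
  rewrite -IE; apply/card_gt0P; exists [ffun i => i]; rewrite inE.
  by apply/injectiveP => i j; rewrite !ffunE.
have S0 : 0 <= \sum_j rnorm (P (x j)) by apply: sumr_ge0 => j _; exact: rnorm_ge0.
have DE_gt0 : 0 < (D * E)%:R :> R by rewrite ltr0n muln_gt0 D0.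
rewrite -(ler_pM2l DE_gt0).
apply: (@le_trans _ _ (rnorm ((D * (I * E))%:R * emb s (\sum_j rnorm (P (x j)))))).
  rewrite rnormM (rnorm_emb _ S0) ler_wpM2r// -(rmorph_nat (emb s)) rnorm_emb ?ler0n//.
  by rewrite ler_nat mulnCA leq_pmull.
rewrite -average.
set w := weak_norm 1 x; have w0 : 0 <= w := weak_norm1_ge0 x.
have bound e d : rnorm ((\prod_i (-1) ^+ (d : {ffun 'I_m -> bool}) i) *
    P (\sum_j t e d j *: x j)) <= M * (m%:R * w) ^+ m.
  rewrite rnormM rnorm_prod big1 ?mul1r => [|i _]; last exact: rnorm_sign.
  rewrite (le_trans (PM _))// ler_wpM2l// lerXn2r ?nnegrE ?rnorm_ge0 ?mulr_ge0//.
  exact: rnorm_sum_le_weak_norm.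
have bound_e e := rnorm_sum_le_card (bound e); rewrite DE in bound_e.
have := rnorm_sum_le_card bound_e; rewrite EE => /le_trans; apply.
by rewrite le_eqVlt; apply/orP; left; apply/eqP; rewrite natrM exprMn; ring.
Qed.

Theorem continuous_poly_abs_summing (q : R) (P : X -> K) :
  1 <= q -> continuous_poly X m P -> abs_summing q 1 m P.
Proof.
move=> q1 /continuous_poly_abs_summing1[L L0 PL]; exists L => // k x.
rewrite (le_trans _ (PL k x))// powR_sum_le_sum// => j.
exact: rnorm_ge0.
Qed.
End DefantVoigt.

(** * The space of bounded sequences *)

Section ScalarFieldComplete.
Variables (R : realType) (s : scalars).
Local Notation K := (scalar_field R s).

(** With [c] the real or the imaginary part, completeness of R supplies one coordinate of the limit
    of a complex Cauchy filter. *)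
Lemma cauchy_coordinate_cvg (c : K -> R) (F : set_system K) :
  (forall x y, `|c x - c y| <= rnorm (x - y)) -> ProperFilter F -> cauchy F ->
  exists l, forall e : R, 0 < e -> \forall z \near F, `|l - c z| < e.
Proof.
move=> cle FF /cauchyP Fc.
have /R_complete/cvg_ex[l cl] : cauchy (c @ F).
  apply/cauchyP => e e0; have [|z Fz] := Fc (emb s e).
    by rewrite -(rmorph0 (emb s)) ltr_emb.
  exists (c z); suff : F (c @^-1` ball (c z) e) by [].
  apply: filterS Fz => y; rewrite -!ball_normE/= ltr_norm_emb; exact: le_lt_trans.
by exists l => e e0; move/cvgrPdist_lt : cl; exact.
Qed.

End ScalarFieldComplete.

Section ComplexModulus.
Variable R : realType.
Implicit Type z : scalar_field R ComplexScalars.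

Lemma abs_Re_le z : `|complex.Re z| <= rnorm z.
Proof. by case: z => a b; rewrite /rnorm/= -sqrtr_sqr ler_wsqrtr// lerDl sqr_ge0. Qed.

Lemma abs_Im_le z : `|complex.Im z| <= rnorm z.
Proof. by case: z => a b; rewrite /rnorm/= -sqrtr_sqr ler_wsqrtr// lerDr sqr_ge0. Qed.

Lemma rnorm_le_abs_Re_Im z : rnorm z <= `|complex.Re z| + `|complex.Im z|.
Proof.
case: z => a b; rewrite /rnorm/= -[leRHS]ger0_norm ?addr_ge0// -sqrtr_sqr.
rewrite ler_wsqrtr// sqrrD !real_normK ?num_real// lerD2r lerDl.
by rewrite mulrn_wge0// mulr_ge0.
Qed.

End ComplexModulus.

Lemma scalar_field_complete (R : realType) (s : scalars)
    (F : set_system (scalar_field R s)) :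
  ProperFilter F -> cauchy F -> cvg F.
Proof.
case: s F => F FF Fc; first exact: (@R_complete R F).
have [|a Fa] := @cauchy_coordinate_cvg R ComplexScalars (@complex.Re R) F _ FF Fc.
  move=> x y; rewrite -raddfB; exact: abs_Re_le.
have [|b Fb] := @cauchy_coordinate_cvg R ComplexScalars (@complex.Im R) F _ FF Fc.
  move=> x y; rewrite -raddfB; exact: abs_Im_le.
apply/cvg_ex; exists (a +i* b); apply/cvgrPdist_lt => _ /gt0_emb[e e0 <-].
have e2 : 0 < e / 2 by rewrite divr_gt0.
near=> z.
rewrite ltr_norm_emb (le_lt_trans (rnorm_le_abs_Re_Im _))// !raddfB/=.
rewrite [ltRHS](splitr e) ltrD//; near: z; [exact: Fa|exact: Fb].
Unshelve. all: by end_near. Qed.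

Section BoundedSequences.
Variables (R : realType) (s : scalars).
Local Notation K := (scalar_field R s).

Definition bounded_seq : {pred nat -> K} :=
  fun f => `[< exists M : R, forall n, rnorm (f n) <= M >].

Lemma bounded_seqP (f : nat -> K) :
  reflect (exists M, forall n, rnorm (f n) <= M) (f \in bounded_seq).
Proof. exact: asboolP. Qed.

Lemma bounded_seq_submod_closed : submod_closed bounded_seq.
Proof.
split=> [|a f g /bounded_seqP[M fM] /bounded_seqP[N gN]]; apply/bounded_seqP.
  by exists 0 => n; rewrite rnorm0.
exists (rnorm a * M + N) => n; rewrite (le_trans (ler_rnormD _ _))//.
by rewrite lerD// rnormM ler_wpM2l ?rnorm_ge0.
Qed.

HB.instance Definition _ := GRing.isSubmodClosed.Build K (nat -> K) bounded_seq
  bounded_seq_submod_closed.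

Record linf := Linf { linf_val :> nat -> K; linfP : linf_val \in bounded_seq }.

HB.instance Definition _ := [isSub for linf_val].
HB.instance Definition _ := [Choice of linf by <:].
HB.instance Definition _ := [SubChoice_isSubLmodule of linf by <:].

Definition linf_sup (x : linf) : R := sup (range (fun n => rnorm (x n))).

Lemma rnorm_le_linf_sup (x : linf) n : rnorm (x n) <= linf_sup x.
Proof.
apply: ub_le_sup; last by exists n.
by have /bounded_seqP[M xM] := linfP x; exists M => _ [k _ <-].
Qed.

Lemma linf_sup_le (x : linf) M : (forall n, rnorm (x n) <= M) -> linf_sup x <= M.
Proof.
move=> xM; apply: ge_sup; last by move=> _ [n _ <-].
by exists (rnorm (x 0%N)), 0%N.
Qed.

Definition linf_norm (x : linf) : K := emb s (linf_sup x).

Lemma linf_normD x y : linf_norm (x + y) <= linf_norm x + linf_norm y.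
Proof.
rewrite /linf_norm -rmorphD ler_emb; apply: linf_sup_le => n.
by rewrite (le_trans (ler_rnormD _ _))// lerD// rnorm_le_linf_sup.
Qed.

Lemma linf_normZ a x : linf_norm (a *: x) = `|a| * linf_norm x.
Proof.
rewrite /linf_norm -emb_rnorm -rmorphM; congr (emb s _).
apply/eqP; rewrite eq_le; apply/andP; split.
  by apply: linf_sup_le => n; rewrite rnormM ler_wpM2l ?rnorm_ge0 ?rnorm_le_linf_sup.
have [->|a0] := eqVneq a 0.
  rewrite rnorm0 mul0r; exact: le_trans (rnorm_ge0 _) (rnorm_le_linf_sup _ 0%N).
have na0 : 0 < rnorm a.
  by rewrite lt_def rnorm_ge0 andbT; apply: contra_neq a0; exact: rnorm0_eq0.
rewrite -ler_pdivlMl//; apply: linf_sup_le => n; rewrite ler_pdivlMl// -rnormM.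
exact: (rnorm_le_linf_sup (a *: x)).
Qed.

Lemma linf_norm_eq0 x : linf_norm x = 0 -> x = 0.
Proof.
rewrite -(rmorph0 (emb s)) => /(can_inj (@embK R s)) x0.
apply/val_inj/funext => n; apply: rnorm0_eq0; apply/eqP.
by rewrite eq_le rnorm_ge0 andbT -x0 rnorm_le_linf_sup.
Qed.

HB.instance Definition _ :=
  Lmodule_isNormed.Build K linf linf_normD linf_normZ linf_norm_eq0.

Lemma rnorm_linfE (x : linf) : rnorm x = linf_sup x.
Proof. exact: rnormP. Qed.

Lemma linf_complete (F : set_system linf) : ProperFilter F -> cauchy F -> cvg F.
Proof.
move=> FF Fc.
have Fclose (e : R) : 0 < e -> exists x : linf, \forall y \near F, rnorm (x - y) < e.
  move=> e0; have /cauchyP/(_ (emb s e)) := Fc.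
  case=> [|x Fx]; first by rewrite -(rmorph0 (emb s)) ltr_emb.
  by exists x; apply: filterS Fx => y; rewrite -ball_normE/= ltr_norm_emb.
have rnorm_val (x y : linf) n : rnorm (x n - y n) <= rnorm (x - y).
  by rewrite rnorm_linfE (rnorm_le_linf_sup (x - y)).
have Fval n : exists l : K, forall e : R, 0 < e ->
    \forall y \near F, rnorm (l - (y : linf) n) < e.
  have /scalar_field_complete/cvg_ex[l Fl] : cauchy ((fun y : linf => y n) @ F).
    apply/cauchyP => _ /gt0_emb[e e0 <-]; have [x Fx] := Fclose _ e0.
    exists (x n); suff : F [set y : linf | ball (x n) (emb s e) (y n)] by [].
    apply: filterS Fx => y xy; rewrite -ball_normE/= ltr_norm_emb.
    exact: le_lt_trans xy.
  exists l => e e0; move/cvgrPdist_lt : Fl => /(_ (emb s e)).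
  rewrite -(rmorph0 (emb s)) ltr_emb => /(_ e0); apply: filterS => y.
  by rewrite ltr_norm_emb.
have [l Fl] := choice Fval.
(* The pointwise limit inherits norm estimates uniformly in [n]; this gives both its boundedness and
   convergence in norm. *)
have limit_close (e : R) (x : linf) : (\forall y \near F, rnorm (x - y) < e) ->
    forall n, rnorm (l n - x n) <= e.
  move=> Fx n; apply/ler_addgt0Pr => d d0; near F => y.
  rewrite -[l n](subrK (y n)) -addrA (le_trans (ler_rnormD _ _))// [e + d]addrC lerD//.
    by apply: ltW; near: y; exact: Fl.
  rewrite -rnormN opprB (le_trans (rnorm_val x y n))//.
  by apply: ltW; near: y.
have lb : l \in bounded_seq.
  have [x Fx] := Fclose 1 ltr01; apply/bounded_seqP.
  exists (1 + rnorm x) => n; rewrite -[l n](subrK (x n)).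
  rewrite (le_trans (ler_rnormD _ _))// lerD ?(limit_close _ _ Fx)//.
  by rewrite rnorm_linfE rnorm_le_linf_sup.
apply/cvg_ex; exists (Linf lb); apply/cvgrPdist_lt => _ /gt0_emb[e e0 <-].
have e3 : 0 < e / 3 by rewrite divr_gt0.
(* The limit is within e / 3 of [x], and [x] within e / 3 of [y], which leaves room for the strict
   inequality. *)
have [x Fx] := Fclose _ e3; apply: filterS (Fx) => y xy.
rewrite ltr_norm_emb -[Linf lb](subrK x) -addrA (le_lt_trans (ler_rnormD _ _))//.
have : rnorm (Linf lb - x) <= e / 3.
  by rewrite rnorm_linfE; apply: linf_sup_le => n; exact: limit_close.
by lra.
Unshelve. all: by end_near. Qed.

HB.instance Definition _ := Uniform_isComplete.Build linf linf_complete.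
End BoundedSequences.

(** * The case [q < 1] *)

Section PowerTelescope.
Variables (R : realType) (q : R).
Hypotheses (q_gt0 : 0 < q) (q_lt1 : q < 1).
(** Chosen so that the differences of consecutive terms n^(-t) decay like n^(-t-1) = n^(-1/q). *)
Let t := q^-1 - 1.
Let t_gt0 : 0 < t.
Proof. by rewrite subr_gt0 invf_gt1. Qed.

(* Of order [n `^ (- q^-1)], hence summable with a divergent series of [q]-th
   powers. *)
Definition power_telescope (n : nat) : R :=
  expR (- (t * ln n.+1%:R)) - expR (- (t * ln n.+2%:R)).

Lemma power_telescope_ge0 n : 0 <= power_telescope n.
Proof.
rewrite subr_ge0 ler_expR lerN2 ler_wpM2l ?(ltW t_gt0)//.
by rewrite ler_ln ?posrE// ler_nat.
Qed.

Lemma power_telescope_sum_le1 n : \sum_(k < n) power_telescope k <= 1.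
Proof.
have -> : \sum_(k < n) power_telescope k = 1 - expR (- (t * ln n.+1%:R)).
  elim: n => [|n IHn]; first by rewrite big_ord0 ln1 mulr0 oppr0 expR0 subrr.
  by rewrite big_ord_recr/= IHn /power_telescope addrA subrK.
by rewrite gerBl expR_ge0.
Qed.

(** With b = ln (n+2) and d = ln (n+2) - ln (n+1), the difference is exp (-t b) * (exp (t d) - 1),
    at least exp (-t b) * t d. Since d >= 1 / (n+2), this is at least t * (n+2)^(-1/q). *)
Lemma power_telescope_powR_ge n :
  t `^ q * n.+2%:R^-1 <= power_telescope n `^ q.
Proof.
pose b := ln (n.+2%:R : R); pose d := b - ln n.+1%:R.
have bE : expR (- b) = n.+2%:R^-1 by rewrite expRN lnK// posrE.
have d_ge : n.+2%:R^-1 <= d.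
  rewrite /d /b -opprB lerNr -ln_div ?posrE//.
  rewrite (_ : n.+1%:R / n.+2%:R = 1 + - n.+2%:R^-1).
    by rewrite le_ln1Dx// ltrN2 invf_lt1// ltr1n.
  have n2 : n.+2%:R != 0 :> R by rewrite pnatr_eq0.
  by apply: (mulIf n2); rewrite divfK// mulrDl mul1r mulNr mulVf// -[n.+2%:R]natr1 addrK.
have a_ge : t * expR (- (q^-1 * b)) <= power_telescope n.
  have -> : power_telescope n = expR (- (t * b)) * (expR (t * d) - 1).
    rewrite mulrBr mulr1 -expRD; congr (expR _ - _); rewrite /d; ring.
  have -> : - (q^-1 * b) = - (t * b) - b by rewrite /t; ring.
  rewrite expRD bE mulrCA ler_wpM2l ?expR_ge0// lerBrDl.
  by rewrite (le_trans _ (expR_ge1Dx _))// lerD2l ler_wpM2l// ltW.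
have := @ge0_ler_powR _ q (ltW q_gt0) _ _ _ _ a_ge; rewrite !nnegrE.
rewrite power_telescope_ge0 mulr_ge0 ?expR_ge0 ?(ltW t_gt0)// => /(_ isT isT).
rewrite powRM ?expR_ge0 ?(ltW t_gt0)// -expRM mulNr mulrAC mulVf ?gt_eqF// mul1r bE.
exact.
Qed.

Lemma power_telescope_powR_unbounded B :
  exists k, B < \sum_(j < k) power_telescope j `^ q.
Proof.
apply: contrapT => /forallNP sum_le; apply: (@dvg_harmonic R).
apply: nondecreasing_is_cvgn.
  by apply: nondecreasing_series => n _ _; exact: harmonic_ge0.
have tq : 0 < t `^ q by exact: powR_gt0.
(* The summand 1 is the first harmonic term; the later terms 1 / (j+2) are those controlled by the
   lower bound on the [q]-th powers. *)
exists (1 + B / t `^ q) => _ [[|k] _ <-].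
  rewrite seriesEord/= big_ord0 addr_ge0// divr_ge0 ?(ltW tq)//.
  by have /negP := sum_le 0%N; rewrite -leNgt big_ord0.
rewrite seriesEord/= big_ord_recl invr1 lerD2l ler_pdivlMr// mulrC mulr_sumr.
have /negP := sum_le k; rewrite -leNgt; apply: le_trans.
by apply: ler_sum => j _; exact: power_telescope_powR_ge.
Qed.

End PowerTelescope.

(** * Scalar series dominated by a summable sequence *)

Section DominatedSeries.
Variables (R : realType) (s : scalars).
Local Notation K := (scalar_field R s).
Variables (a : nat -> R).
Hypotheses (a_ge0 : forall n, 0 <= a n) (a_sum : forall n, \sum_(k < n) a k <= 1).

Lemma cvg_dominated_series (C : R) (u : nat -> K) :
  (forall n, rnorm (u n) <= C * a n) -> cvgn (series u).
Proof.
move=> uC; apply: scalar_field_complete; apply/cauchy_seriesP => _ /gt0_emb[e e0 <-].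
(* [C] may be zero, so the tolerance is divided by |C| + 1 instead. *)
have C0 : 0 < `|C| + 1 by rewrite ltr_wpDl.
have /cvg_cauchy/cauchy_seriesP/(_ (e / (`|C| + 1)) _) : cvgn (series a).
  apply: nondecreasing_is_cvgn; first exact: nondecreasing_series.
  by exists 1 => _ [n _ <-]; rewrite seriesEord/=; exact: a_sum.
rewrite divr_gt0// => /(_ isT); apply: filterS => n.
rewrite ger0_norm ?sumr_ge0// ltr_pdivlMr// ltr_norm_emb => /le_lt_trans; apply.
rewrite (le_trans (ler_rnorm_sum _ _ _))// mulr_suml ler_sum// => k _.
rewrite (le_trans (uC k))// mulrC ler_wpM2l// (le_trans (ler_norm C))// lerDl.
exact: ler01.
Qed.

Lemma rnorm_lim_series_le (C : R) (u : nat -> K) : 0 <= C ->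
  (forall n, rnorm (u n) <= C * a n) -> rnorm (limn (series u)) <= C.
Proof.
move=> C0 uC; have /cvgrPdist_lt u_cvg := cvg_dominated_series uC.
apply/ler_addgt0Pr => e e0; have := u_cvg (emb s e).
rewrite -(rmorph0 (emb s)) ltr_emb => /(_ e0) u_near; near \oo => n.
rewrite -(subrK (series u n) (limn _)) (le_trans (ler_rnormD _ _))// addrC lerD//.
  rewrite seriesEord/= (le_trans (ler_rnorm_sum _ _ _))//.
  rewrite (@le_trans _ _ (\sum_(k < n) C * a k)) ?ler_sum// -mulr_sumr.
  by rewrite ler_piMr.
by rewrite ltW// -ltr_norm_emb; near: n.
Unshelve. all: by end_near. Qed.

Lemma lim_series_linear (c : K) (u v : nat -> K) :
  cvgn (series u) -> cvgn (series v) ->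
  limn (series (fun n => c * u n + v n)) = c * limn (series u) + limn (series v).
Proof.
move=> u_cvg v_cvg; apply/cvg_lim => //.
have -> : series (fun n => c * u n + v n) = (fun n => c * series u n + series v n).
  by apply/funext => n; rewrite !seriesEord/= mulr_sumr -big_split.
by apply: cvgD => //; apply: cvgM => //; exact: cvg_cst.
Qed.

End DominatedSeries.

(** * The diagonal polynomial on bounded sequences *)

Section SeriesPolynomial.
Variables (R : realType) (s : scalars).
Local Notation K := (scalar_field R s).
Local Notation X := (linf R s).
Variables (a : nat -> R) (m : nat).
Hypotheses (a_ge0 : forall n, 0 <= a n) (a_sum : forall n, \sum_(k < n) a k <= 1).
Hypothesis m_gt0 : (0 < m)%N.

Definition series_form (v : 'I_m -> X) : K :=
  limn (series (fun n => emb s (a n) * \prod_i v i n)).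

Definition series_poly (x : X) : K := series_form (fun=> x).

Lemma rnorm_linf_ge (x : X) n : rnorm (x n) <= rnorm x.
Proof. by rewrite rnorm_linfE rnorm_le_linf_sup. Qed.

Lemma cvg_series_form (v : 'I_m -> X) :
  cvgn (series (fun n => emb s (a n) * \prod_i v i n)).
Proof.
apply: (cvg_dominated_series a_ge0 a_sum (C := \prod_i rnorm (v i))) => n.
rewrite rnormM rnorm_emb// mulrC ler_wpM2r// rnorm_prod.
by apply: ler_prod => i _; rewrite rnorm_ge0 rnorm_linf_ge.
Qed.

Lemma series_form_multilinear : multilinear_form series_form.
Proof.
move=> v i c x y; rewrite /series_form -lim_series_linear; try exact: cvg_series_form.
congr (limn (series _)); apply/funext => n.
have E z : \prod_l (dfwith v i z) l n = z n * \prod_(l | l != i) v l n.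
  rewrite (bigD1 i)//= dfwithin; congr (_ * _); apply: eq_bigr => l li.
  by rewrite dfwithout// eq_sym.
rewrite !E (_ : (c *: x + y) n = c * x n + y n)//; ring.
Qed.

(** Factor out x - y: the cofactor has [m] terms, each a product of m - 1 factors bounded by [B]. *)
Lemma rnorm_subXX_le (x y : K) (B : R) : rnorm x <= B -> rnorm y <= B ->
  rnorm (x ^+ m - y ^+ m) <= rnorm (x - y) * (m%:R * B ^+ m.-1).
Proof.
move=> xB yB; have B0 := le_trans (rnorm_ge0 _) xB.
rewrite subrXX rnormM ler_wpM2l ?rnorm_ge0// (le_trans (ler_rnorm_sum _ _ _))//.
rewrite mulr_natl -[X in _ *+ X](card_ord m) -sumr_const ler_sum// => i _.
have im : (i <= m.-1)%N by rewrite -ltnS prednK.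
rewrite rnormM !rnormX -[in leRHS](subnK im) exprD.
by rewrite ler_pM ?exprn_ge0 ?rnorm_ge0// lerXn2r ?nnegrE ?rnorm_ge0.
Qed.

Lemma series_poly_continuous : continuous series_poly.
Proof.
move=> x; pose B := rnorm x + 1; have B0 : 0 < B by rewrite ltr_wpDl ?rnorm_ge0.
pose C := m%:R * B ^+ m.-1; have C0 : 0 < C by rewrite mulr_gt0 ?ltr0n ?exprn_gt0.
apply: (locally_lipschitz_continuous C0) => y xy1.
have yB : rnorm y <= B.
  rewrite -[y](subKr x) (le_trans (ler_rnormD _ _))// rnormN lerD2l.
  exact: ltW.
(* The difference of the two limits is the limit of one series, whose [n]-th term is at most |x - y|
   * C * a_n. *)
rewrite addrC -mulN1r -lim_series_linear; try exact: cvg_series_form.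
apply: (rnorm_lim_series_le a_ge0 a_sum) => [|n].
  by rewrite mulr_ge0 ?rnorm_ge0 ?(ltW C0).
rewrite !prodr_const card_ord mulN1r -mulrN -mulrDr addrC.
rewrite rnormM rnorm_emb// mulrC ler_wpM2r//.
have xB : rnorm x <= B by rewrite lerDl.
rewrite (le_trans (rnorm_subXX_le (le_trans (rnorm_linf_ge x n) xB)
  (le_trans (rnorm_linf_ge y n) yB)))//.
by rewrite ler_wpM2r ?(ltW C0)// (rnorm_linf_ge (x - y)).
Qed.

Lemma series_poly_continuous_poly : continuous_poly X m series_poly.
Proof.
split; last exact: series_poly_continuous.
by exists series_form => //; exact: series_form_multilinear.
Qed.

Lemma unit_seq_bounded j : (fun n => (n == j)%:R : K) \in @bounded_seq R s.
Proof.
apply/bounded_seqP; exists 1 => n; case: (n == j); first by rewrite rnorm1.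
by rewrite rnorm0.
Qed.

Definition unit_seq j : X := Linf (unit_seq_bounded j).

Lemma series_poly_unit_seq j : series_poly (unit_seq j) = emb s (a j).
Proof.
apply/cvg_lim => //; apply: cvg_near_cst; exists j.+1 => // n /= jn.
rewrite seriesEord/= (bigD1 (Ordinal jn))//= [X in _ + X]big1 ?addr0 => [|i ij].
  by rewrite prodr_const eqxx expr1n mulr1.
rewrite prodr_const card_ord (_ : (i == j :> nat) = false).
  by rewrite expr0n eqn0Ngt m_gt0 mulr0.
by apply/negbTE.
Qed.

(** Rotating each psi (e_j) to its modulus by some |c_j| <= 1 turns the sum into the value of [psi]
    at \sum_j c_j e_j, whose supremum norm is at most 1 because the e_j have disjoint supports. *)
Lemma weak_norm_unit_seq k : weak_norm 1 (fun j : 'I_k => unit_seq j) <= 1.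
Proof.
have [phi phi1 _] := exists_norming_functional (0 : X).
apply: ge_sup; first by eexists; exists phi.
move=> _ [psi psi1 <-]; rewrite invr1 powRr1; last first.
  by apply: sumr_ge0 => j _; exact: powR_ge0.
under eq_bigr do rewrite powRr1 ?rnorm_ge0//.
have /choice[c cP] : forall j : 'I_k, exists c : K,
    rnorm c <= 1 /\ c * psi (unit_seq j) = emb s (rnorm (psi (unit_seq j))).
  by move=> j; have [c c1 cE] := exists_unit_rotation (psi (unit_seq j)); exists c.
have E : psi (\sum_(j < k) c j *: unit_seq j) =
    emb s (\sum_(j < k) rnorm (psi (unit_seq j))).
  rewrite linear_sum rmorph_sum; apply: eq_bigr => j _.
  by rewrite linearZ/=; case: (cP j).
have S0 : 0 <= \sum_(j < k) rnorm (psi (unit_seq j)).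
  by apply: sumr_ge0 => j _; exact: rnorm_ge0.
rewrite -[leLHS](rnorm_emb s S0).
rewrite -E (le_trans (dual_unit_ballP psi1 _))// rnorm_linfE.
apply: linf_sup_le => n.
have -> : (\sum_(j < k) c j *: unit_seq j) n = \sum_(j < k) c j * (n == j)%:R.
  pose M := GRing.isLinear.Build K X K *:%R (fun x : X => x n) (fun _ _ _ => erefl).
  exact: (linear_sum (HB.pack_for {scalar X} (fun x : X => x n) M)).
case: (ltnP n k) => [nk|kn].
  rewrite (bigD1 (Ordinal nk))//= eqxx mulr1 big1 ?addr0.
    by case: (cP (Ordinal nk)).
  by move=> i ni; rewrite (_ : (n == i) = false) ?mulr0//; apply/negbTE; rewrite eq_sym.
rewrite big1 ?rnorm0 ?ler01// => i _; rewrite gtn_eqF ?mulr0//.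
exact: leq_trans (ltn_ord i) kn.
Qed.

End SeriesPolynomial.

Theorem corollary3 (R : realType) (s : scalars) (m : nat) (hm : (0 < m)%N)
    (q : R) (hq : 0 < q) :
  (forall X : completeNormedModType (scalar_field R s),
     abs_summing_poly X q 1 m = continuous_poly X m) <-> 1 <= q.
Proof.
split=> [summing|q1 X]; last first.
  apply/seteqP; split=> [P []//|P cP].
  by split=> //; exact: continuous_poly_abs_summing.
rewrite leNgt; apply/negP => q_lt1.
pose a := power_telescope q; have a0 := power_telescope_ge0 hq q_lt1.
have a1 n : \sum_(k < n) a k <= 1 := power_telescope_sum_le1 q n.
have := series_poly_continuous_poly s a0 a1 hm.
rewrite -(summing (linf R s)) => -[_ [L L0 PL]].
(* For this [k] the sum of [q]-th powers exceeds L^q, while the summing inequality at the first [k]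
   unit vectors, of weak norm at most 1, bounds the same sum by L^q. *)
have [k] := power_telescope_powR_unbounded hq q_lt1 (L `^ q).
apply/negP; rewrite -leNgt.
have /= := PL k (fun j => unit_seq R s j).
under eq_bigr do rewrite (series_poly_unit_seq s a hm) rnorm_emb//.
move=> sum_le; have {}sum_le := le_trans sum_le (ler_piMr L0 _).
have S0 : 0 <= \sum_(j < k) a j `^ q by apply: sumr_ge0 => j _; exact: powR_ge0.
rewrite -[leLHS](powRr1 S0) -(mulVf (lt0r_neq0 hq)) powRrM.
apply: ge0_ler_powR; rewrite ?nnegrE ?powR_ge0 ?(ltW hq)//.
by apply: sum_le; rewrite exprn_ile1 ?weak_norm1_ge0 ?weak_norm_unit_seq.
Qed.
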